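(* Let $d\ge1$, $D=\{1,\dots,d\}$, let $X=(X_1,\dots,X_d)\sim P_X$ be a random vector with values in a product $E=E_1\times\dots\times E_d$ of Polish spaces, and let $G\in L^2(P_X;\mathbb{R})$. For every $A\subseteq D$ let $f_A:E_A\to\mathbb{R}$ be a measurable function with $f_A(X_A)=\mathbb{E}[G(X)\mid X_A]$ almost surely, and let $\varphi_A=\mathbb{V}(f_A(X_A))=\mathbb{V}(\mathbb{E}[G(X)\mid X_A])$. Then the output variance admits the following gradual Möbius decomposition: $$\mathbb{V}(G(X))=\sum_{A\in\mathcal{P}(D)}\psi_A,\qquad \psi_A=\sum_{B\subseteq A}(-1)^{|A|-|B|}\,\mathbb{V}\big(\mathbb{E}[G(X)\mid X_B]\big)\quad\text{for all }A\in\mathcal{P}(D).$$ Additionally, if the inputs are independent (i.e. $P_X=\prod_{i=1}^d P_{X_i}$) and $\mathbb{V}(G(X))\neq 0$, then this decomposition is also fractional, i.e. $\psi_A\ge 0$ for every $A\in\mathcal{P}(D)$ (so that the ratios $\psi_A/\mathbb{V}(G(X))$ all lie in $[0,1]$ and sum to $1$).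
   Context: $\mathcal{P}(D)$ is the power set of $D$, $|A|$ the cardinality of $A$. For $A\subseteq D$, $E_A=\prod_{i\in A}E_i$ with its Borel $\sigma$-algebra, and $X_A=(X_i)_{i\in A}$; for $A=\emptyset$, $X_\emptyset$ is trivial, so $\mathbb{E}[\,\cdot\mid X_\emptyset]=\mathbb{E}[\,\cdot\,]$. $\mathbb{V}$ denotes variance. The quantity of interest is $\phi_{P_X}(H)=\mathbb{V}(H(X))$ for $H\in L^2(P_X;\mathbb{R})$. A Möbius decomposition of a quantity of interest $\phi_{P_X}(G)$ is an identity $\phi_{P_X}(G)=\sum_{A\in\mathcal{P}(D)}\psi_A$ with $\psi_A=\sum_{B\subseteq A}(-1)^{|A|-|B|}\varphi_B$ for a set function $\varphi$ on $\mathcal{P}(D)$ with $\varphi_D=\phi_{P_X}(G)$. It is gradual if for every $A$, $\varphi_A=\phi_{P_X}(f_A)$ for some measurable function $f_A$ on $E_A$ with values in the same space as $G$ (regarded as a function on $E$ depending only on the coordinates in $A$). A Möbius decomposition of a non-zero real quantity of interest is fractional if every $\psi_A$ has the same sign as $\phi_{P_X}(G)$, where $0$ is regarded as compatible with either sign (equivalently, all ratios $\psi_A/\phi_{P_X}(G)$ are $\ge0$). *)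

(* Defs.v *)
From HB Require Import structures.
From mathcomp Require Import all_boot all_order all_algebra.
From mathcomp Require Import all_classical all_reals all_analysis.

Set Implicit Arguments.
Unset Strict Implicit.
Unset Printing Implicit Defensive.

Import Order.TTheory GRing.Theory Num.Theory.

Local Open Scope classical_set_scope.
Local Open Scope ring_scope.

(* Polish spaces: the metric is only required to exist, up to homeomorphism;
   [cauchy] and [-->] refer to the uniformity and topology of that metric. *)
Definition polish_space (R : realType) (T : topologicalType) : Prop :=
  (exists2 S : set T, countable S & dense S) /\
  exists (M : metricType R) (f : T -> M) (g : M -> T),
    [/\ cancel f g, cancel g f, continuous f, continuous g
      & forall F : set_system M, ProperFilter F -> cauchy F ->
          exists x : M, F --> x].

Notation borel T := (g_sigma_algebraType (@open T)).

(* The library builds Borel measurable types over pointed types only; a product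
   carrying a probability measure has non-empty factors anyway. *)
HB.instance Definition _ (I : Type) (E : I -> ptopologicalType) :=
  Pointed.on (prod_topology E).

Section Products.
Context (d : nat) (E : 'I_d -> ptopologicalType).

Definition fullprod : ptopologicalType := prod_topology E.

(* When A is empty, this is a one-point space. *)
Definition subprod (A : {set 'I_d}) : ptopologicalType :=
  prod_topology (fun i : {i : 'I_d | i \in A} => E (val i)).

Definition restr (A : {set 'I_d}) (x : fullprod) : subprod A :=
  fun i => x (val i).

(* A law is the product of its marginals: they agree on measurable boxes, which
   form a pi-system generating the Borel sigma-algebra of the product, the
   factors being second countable in all uses. *)
Definition is_product_law (R : realType) (mu : set (borel fullprod) -> \bar R)
    : Prop :=
  forall B : forall i, set (E i),
    (forall i, measurable (B i : set (borel (E i)))) ->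
    mu [set x : fullprod | forall i, B i (x i)] =
    (\prod_(i < d) pushforward mu (fun x : fullprod => x i : borel (E i)) (B i))%E.

End Products.

(* W is a version of the conditional expectation of the integrable variable Y
   given Z, i.e. given the sigma-algebra of the events Z @^-1` C. *)
Definition is_cond_expectation d d' (T : measurableType d)
    (T' : measurableType d') (R : realType) (P : probability T R)
    (Y : T -> R) (Z : T -> T') (W : T -> R) : Prop :=
  let sigmaZ : set (set T) := preimage_set_system setT Z measurable in
  [/\ forall U : set R, measurable U -> sigmaZ (W @^-1` U),
      P.-integrable setT (EFin \o W)
    & forall B, sigmaZ B ->
        (\int[P]_(w in B) (W w)%:E = \int[P]_(w in B) (Y w)%:E)%E].

(* The variance of the library is extended-real valued; it is finite on
   square-integrable functions, the domain of this quantity of interest. *)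
Definition output_variance d d' (T : measurableType d)
    (T' : measurableType d') (R : realType) (P : probability T R)
    (X : T -> T') (H : T' -> R) : R :=
  fine (variance P (H \o X)).

Section Moebius.
Context (R : realType) (d : nat).
Implicit Types (varphi psi : {set 'I_d} -> R).

Definition moebius varphi (A : {set 'I_d}) : R :=
  \sum_(B : {set 'I_d} | B \subset A) (-1) ^+ (#|A| - #|B|) * varphi B.

Definition moebius_decomposition (q : R) varphi psi : Prop :=
  [/\ q = \sum_(A : {set 'I_d}) psi A,
      forall A, psi A = moebius varphi A
    & varphi [set: 'I_d]%SET = q].

(* [phi] is a quantity of interest, meaningful on the functions in [dom]. *)
Definition gradual (E : 'I_d -> ptopologicalType)
    (dom : set (fullprod E -> R)) (phi : (fullprod E -> R) -> R) varphi
    : Prop :=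
  forall A : {set 'I_d}, exists f : subprod E A -> R,
    [/\ measurable_fun [set: borel (subprod E A)] f,
        dom (f \o @restr d E A)
      & varphi A = phi (f \o @restr d E A)].

Definition fractional (q : R) psi : Prop :=
  q != 0 /\ forall A, if 0 < q then 0 <= psi A else psi A <= 0.

End Moebius.

(* Main.v *)
Require Import Defs.
From HB Require Import structures.
From mathcomp Require Import all_boot all_order all_algebra.
From mathcomp Require Import finmap all_classical all_reals all_analysis.
From mathcomp Require Import measurable_realfun.
From mathcomp Require Import ring.

Set Implicit Arguments.
Unset Strict Implicit.
Unset Printing Implicit Defensive.

Import Order.TTheory GRing.Theory Num.Theory.

Local Open Scope classical_set_scope.
Local Open Scope ring_scope.

(** The variances of the conditional expectations [W_A = E[Y | X_A]] of
    [Y = G(X)] are finite because conditioning contracts L2, and [W_D = Y], so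
    the decomposition is Moebius inversion on the subsets of [D].  When the
    inputs are independent, [W_B - W_(B :&: C)] is centered given [X_C], hence
    [cov (W_B, W_C) = V (W_(B :&: C))].  Expanding the variance of
    [\sum_(B \subset A) (-1) ^ (#|A| - #|B|) W_B] with this identity gives
    exactly [psi_A], which is therefore nonnegative. *)

(** Each [f A] evaluated at X_A is known only through its integrals over the events of X_A, and is
    at first merely integrable. Orthogonality cannot simply be invoked to show that conditioning
    contracts L2: pairing W with Y - W presupposes that the product is integrable. Hence the pairing
    of a function of Z with a variable centered given Z is established whenever the product is
    integrable, and is first applied to bounded truncations. The second obstacle is that the product
    law is given on boxes only, while being centered given X_C concerns every Borel set of E_C. The
    pi-lambda theorem bridges the gap once the open boxes are known to generate the Borel
    sigma-algebra, which is where second countability of Polish spaces enters. Independence is then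
    used one event at a time, through centered indicators of cylinders, so that no joint law has to
    be disintegrated. *)

(** * Second countability of Polish spaces *)

Section SecondCountable.
Context {R : realType}.

Lemma polish_second_countable (T : topologicalType) :
  polish_space R T -> @second_countable T.
Proof.
move=> [[S cS dS] [M [f [g [fK gK cf cg _]]]]].
pose B (n : nat) (s : T) : set T := f @^-1` (ball (f s) n.+1%:R^-1)°.
exists (\bigcup_n (B n @` S)).
  by apply: bigcup_countable => // n _; exact: sub_countable (card_image_le _ _) cS.
split=> [_ [n _ [s _ <-]]|x U].
  by move/continuousP : cf; apply; exact: open_interior.
rewrite -{1}(fK x) => xU.
have /nbhs_ballP[_/posnumP[e] eU] : nbhs (f x) (g @^-1` U) by exact: cg.
(* Half of [e], because points of the basic set are compared with [x] through its centre [s]. *)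
have [//|N] := @ltr_add_invr R 0 (e%:num / 2) _; rewrite add0r => Ne.
have N0 : (0 : R) < N.+1%:R^-1 by rewrite invr_gt0.
have oBx : open_nbhs x (f @^-1` (ball (f x) N.+1%:R^-1)°).
  split; first by move/continuousP : cf; apply; exact: open_interior.
  exact: nbhsx_ballx.
have [s [bs Ss]] : (f @^-1` (ball (f x) N.+1%:R^-1)°) `&` S !=set0.
  by apply: dS oBx.1; exists x; exact: oBx.2.
exists (B N s).
  split; first by exists N => //; exists s.
  (* Being in the interior of a ball is not visibly symmetric in point and centre; the slack left by
     the distance from [f x] to [f s] provides the radius. *)
  have [e' e'0 bxe'] : exists2 e' : R, 0 < e' &
      ball (f x) e' `<=` (ball (f s) N.+1%:R^-1).
    have := interior_subset bs; rewrite ballEmdist/= => xs.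
    exists (N.+1%:R^-1 - mdist (f x) (f s)); first by rewrite subr_gt0.
    move=> z; rewrite !ballEmdist/= => xz.
    rewrite (le_lt_trans (metric_triangle _ (f x) _))// metric_sym.
    by rewrite -ltrBrDl.
  by apply/nbhs_ballP; exists e'.
move=> z /interior_subset bz; rewrite /= -(fK z); apply: eU.
rewrite [_%:num]splitr; apply: (@ball_triangle _ _ (f s)).
  by apply: (le_ball (ltW Ne)); exact: interior_subset.
by apply: (le_ball (ltW Ne)).
Qed.

End SecondCountable.

(** * Open boxes in finite products and the Borel sigma-algebra *)

Section Boxes.
Context (I : finType).

Definition box (T : I -> Type) (B : forall i, set (T i)) :
  set (prod_topology T) := [set x | forall i, B i (x i)].

(** The open boxes around [x] are the base of a filter. It converges to [x] because the product
    topology is a supremum, so that convergence is tested on one coordinate at a time, by boxes with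
    a single constrained side. *)
Lemma nbhs_open_box (T : I -> topologicalType) (x : prod_topology T)
    (U : set (prod_topology T)) : nbhs x U ->
  exists2 B : forall i, set (T i), (forall i, open_nbhs (x i) (B i)) &
    box B `<=` U.
Proof.
pose F := filter_from
  [set B : forall i, set (T i) | forall i, open_nbhs (x i) (B i)] (@box T).
have FF : Filter F.
  apply: filter_from_filter; first by exists (fun=> setT) => i; split; [exact: openT|].
  move=> B C Bx Cx; exists (fun i => B i `&` C i).
    by move=> i; split; [apply: openI; [exact: (Bx i).1|exact: (Cx i).1]|
                         split; [exact: (Bx i).2|exact: (Cx i).2]].
  by move=> y yBC; split=> i; case: (yBC i).
suff Fx : F --> x by move=> /Fx[B /= Bx BU]; exists B.
apply/cvg_sup => i W; rewrite nbhsE => -[_ [[V oV <-] /= Vx] VW].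
exists (dfwith (fun=> setT) i V) => /=.
  by move=> j; case: dfwithP => [|k _]; split=> //; exact: openT.
move=> y /(_ i); rewrite dfwithin => Vy; exact: VW.
Qed.

Lemma second_countable_enum (T : topologicalType) : @second_countable T ->
  exists e : nat -> set T, (forall n, open (e n)) /\
    forall x U, nbhs x U -> exists2 n, e n x & e n `<=` U.
Proof.
move=> [B cB [Bo Bx]]; have [B0|/set0P[b Bb]] := eqVneq B set0.
  exists (fun=> setT); split=> [n|x U xU]; first exact: openT.
  by have [V] := Bx x U xU; rewrite B0 => -[].
have /pfcard_geP[B1|[e]] := cB; first by rewrite B1 in Bb.
exists e; split=> [n|x U /Bx[V [BV Vx] VU]].
  by apply: Bo; exact: funS.
by have [n _ en] := @surj _ _ _ _ e V BV; exists n; rewrite en.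
Qed.

(** With sides drawn from countable bases and finitely many coordinates, there are only countably
    many boxes to choose from, so an open set is a countable union of those it contains. *)
Lemma open_box_generated (T : I -> ptopologicalType) :
  (forall i, @second_countable (T i)) ->
  @open (prod_topology T) `<=`
  <<s [set U | exists2 B : forall i, set (T i), forall i, open (B i) & U = box B] >>.
Proof.
move=> sc U oU; set G := (X in <<s X >>).
have [e eP] := all_tag (fun i => cid (second_countable_enum (sc i))).
have eo i := (eP i).1; have enbhs i := (eP i).2.
pose V (n : {ffun I -> nat}) : set (prod_topology T) :=
  if `[< box (fun i => e i (n i)) `<=` U >] then box (fun i => e i (n i)) else set0.
suff -> : U = \bigcup_n V n.
  apply: (@countable_bigcupT_measurable _ (g_sigma_algebraType G)) => [|n].
    exact: countableP.
  rewrite /V; case: asboolP => [_|_]; last exact: measurable0.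
  by apply: sub_sigma_algebra; exists (fun i => e i (n i)).
apply/seteqP; split=> [x Ux|x [n _]]; last first.
  by rewrite /V; case: asboolP => // VU; exact: VU.
have /nbhs_open_box[B Bx BU] : nbhs x U by exact: open_nbhs_nbhs.
have [n nP] := all_tag (fun i => cid2 (enbhs i _ _ (open_nbhs_nbhs (Bx i)))).
exists [ffun i => n i] => //; rewrite /V; case: asboolP => [_|].
  by move=> i; rewrite ffunE; case: (nP i).
case; apply: subset_trans BU => y + i => /(_ i); rewrite ffunE; case: (nP i) => _; exact.
Qed.

End Boxes.

(** * Boxes over a subset of the coordinates *)

Section Subboxes.
Context {R : realType} {d : nat} {E : 'I_d -> ptopologicalType}.
Hypothesis polishE : forall i, polish_space R (E i).

Lemma open_box (I : finType) (T : I -> topologicalType)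
    (B : forall i, set (T i)) : (forall i, open (B i)) ->
  open (box B : set (prod_topology T)).
Proof.
move=> oB; rewrite openE => x Bx.
apply: (@filter_forall _ I (fun i => [set y : prod_topology T | B i (y i)])
  (nbhs x)) => i.
by apply: (@proj_continuous _ T i x); apply: open_nbhs_nbhs.
Qed.

(* Sides are indexed by all of ['I_d], so that boxes over different sets of
   coordinates can be cut out of a common family of sides. *)
Definition subbox (A : {set 'I_d}) (B : forall i, set (E i)) :
  set (subprod E A) := [set z | forall i : {i | i \in A}, B (val i) (z i)].
Arguments subbox : clear implicits.

Definition open_subboxes (A : {set 'I_d}) : set (set (subprod E A)) :=
  [set U | exists2 B : forall i, set (E i), forall i, open (B i) & U = subbox A B].
Arguments open_subboxes : clear implicits.

Lemma open_subbox (A : {set 'I_d}) (B : forall i, set (E i)) :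
  (forall i, open (B i)) -> open (subbox A B).
Proof.
move=> oB; apply: (@open_box _ _ (fun i : {i | i \in A} => B (val i))) => i.
exact: oB.
Qed.

Lemma setI_closed_open_subboxes (A : {set 'I_d}) :
  setI_closed (open_subboxes A).
Proof.
move=> _ _ [B oB ->] [C oC ->]; exists (fun i => B i `&` C i).
  by move=> i; exact: openI.
apply/seteqP; split=> [z [zB zC] i|z zBC]; first by split; [exact: zB|exact: zC].
by split=> i; case: (zBC i).
Qed.

Lemma borel_subprodE (A : {set 'I_d}) :
  (@measurable _ (borel (subprod E A)) : set (set (subprod E A))) =
  <<s open_subboxes A>>.
Proof.
apply/seteqP; split; last first.
  apply: smallest_sub; first exact: smallest_sigma_algebra.
  by move=> _ [B oB ->]; apply: sub_sigma_algebra; exact: open_subbox.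
apply: smallest_sub; first exact: smallest_sigma_algebra.
move=> U /open_box_generated; apply.
  by move=> i; apply: polish_second_countable; exact: polishE.
split; first exact: smallest_sigma_algebra.
move=> _ [B oB ->]; apply: sub_sigma_algebra.
(* Quantifying over the membership proof extends the sides to all indices: outside [A] the condition
   is vacuous and the side is the whole space. *)
exists (fun i => [set y : E i | forall iA : i \in A, B (exist _ i iA) y]).
  move=> i; have [iA|iA] := EM (i \in A); last first.
    rewrite [X in open X](_ : _ = setT); first exact: openT.
    by apply/seteqP; split=> // y _ iA'.
  rewrite [X in open X](_ : _ = B (exist _ i iA)); first exact: oB.
  apply/seteqP; split=> [y|y By iA']; first exact.
  by rewrite (bool_irrelevance iA' iA).
apply/seteqP; split=> [z zB [i iA0] iA|z zB [i iA]].
  by rewrite (bool_irrelevance iA iA0); exact: zB.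
exact: (zB (exist _ i iA) iA).
Qed.

Lemma measurable_restr (A : {set 'I_d}) :
  measurable_fun setT (@restr d E A : borel (fullprod E) -> borel (subprod E A)).
Proof.
apply: (@measurability _ _ (borel (fullprod E)) (borel (subprod E A)) setT
  (@restr d E A) (open_subboxes A)); first exact: borel_subprodE.
move=> _ [_ [B oB ->] <-]; rewrite setTI; apply: sub_sigma_algebra.
rewrite (_ : _ @^-1` _ = box (fun i => [set y | i \in A -> B i y])).
  apply: open_box => i; have [iA|iA] := boolP (i \in A).
    rewrite [X in open X](_ : _ = B i)//; apply/seteqP; split=> y //=; exact.
  rewrite [X in open X](_ : _ = setT); first exact: openT.
  by apply/seteqP; split.
apply/seteqP; split=> [x xB i iA|x xB [i iA]]; last exact: xB.
exact: (xB (exist _ i iA)).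
Qed.

(** The full [subprod] is indexed by a sigma type and differs from [fullprod E]; this map lets a
    function of X be read as a function of X_D. *)
Definition unrestr (z : subprod E [set: 'I_d]%SET) : fullprod E :=
  fun i => z (exist _ i (finset.in_setT i)).

Lemma measurable_unrestr : measurable_fun setT
  (unrestr : borel (subprod E [set: 'I_d]%SET) -> borel (fullprod E)).
Proof.
apply: (@measurability _ _ (borel (subprod E [set: 'I_d]%SET))
  (borel (fullprod E)) setT unrestr (@open (fullprod E))) => //.
move=> _ [U oU <-]; rewrite setTI; apply: sub_sigma_algebra.
rewrite openE => z Uz.
have /nbhs_open_box[B Bz BU] : nbhs (unrestr z : prod_topology E) U.
  exact: open_nbhs_nbhs.
rewrite /interior nbhsE; exists (subbox [set: 'I_d]%SET B).
  split; first by apply: open_subbox => i; case: (Bz i).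
  move=> [i iT]; case: (Bz i) => _; rewrite /unrestr /=.
  by rewrite (bool_irrelevance (finset.in_setT i) iT).
by move=> y By; apply: BU => i; exact: (By (exist _ i (finset.in_setT i))).
Qed.

End Subboxes.

Arguments subbox {d E} A B.
Arguments open_subboxes {d E} A.

(** * Variables centered given Z, and their pairing with functions of Z *)

Section CenteredGiven.
Import HBNNSimple numFieldNormedType.Exports.
Local Open Scope ereal_scope.
Context {dT dZ : measure_display} {T : measurableType dT}
  {S : measurableType dZ} {R : realType} (P : probability T R).
Implicit Types (D : T -> R) (Z : T -> S) (k : S -> R) (A : set T).

(* [E[D | Z] = 0], without choosing a version of the conditional expectation. *)
Definition centered_given Z D : Prop :=
  P.-integrable setT (EFin \o D) /\
  forall C, measurable C -> \int[P]_(w in Z @^-1` C) (D w)%:E = 0.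

Lemma integrable_restrict D A : measurable A ->
  P.-integrable setT (EFin \o D) -> P.-integrable A (EFin \o D).
Proof. by move=> mA; apply: integrableS. Qed.

Lemma integral_setC_EFin D A : measurable A ->
  P.-integrable setT (EFin \o D) ->
  \int[P]_w (D w)%:E = \int[P]_(w in A) (D w)%:E + \int[P]_(w in ~` A) (D w)%:E.
Proof.
move=> mA iD; rewrite -[in LHS](setUv A) integral_setU//.
- exact: measurableC.
- by rewrite setUv; exact: measurable_int iD.
- exact/disj_setPCl.
Qed.

(** The sets over whose preimage [D] integrates to zero form a Dynkin system; [G setT] makes the
    total integral vanish, which handles complements. *)
Lemma centered_given_generated Z D (G : set (set S)) :
  measurable_fun setT Z -> @measurable _ S = <<s G>> -> setI_closed G ->
  G setT -> P.-integrable setT (EFin \o D) ->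
  (forall C, G C -> \int[P]_(w in Z @^-1` C) (D w)%:E = 0) ->
  centered_given Z D.
Proof.
move=> mZ SG GI GT iD GD; split=> // C; rewrite SG => sC.
have mpre B : measurable B -> measurable (Z @^-1` B).
  by move=> mB; rewrite -[X in measurable X]setTI; exact: mZ.
apply: (dynkin_induction (P := [set C | \int[P]_(w in Z @^-1` C) (D w)%:E = 0])
  SG GI) => //=; first exact: GD.
- move=> B mB IB; rewrite preimage_setC.
  have := integral_setC_EFin (mpre _ mB) iD.
  by rewrite IB add0e -[in X in X = _](@preimage_setT _ _ Z) GD.
- move=> F mF tF IF; rewrite preimage_bigcup integral_bigcup.
  + by apply: eseries0 => i _ _; exact: IF.
  + by move=> i j _ _ [w [Fi Fj]]; apply: tF => //; exists (Z w).
  + by move=> n; exact: mpre.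
  + apply: integrable_restrict => //.
    by apply: bigcup_measurable => n _; exact: mpre.
Qed.

Lemma integral_centered_given_nnsfun Z D (g : {nnsfun S >-> R}) :
  measurable_fun setT Z -> centered_given Z D ->
  \int[P]_w (g (Z w) * D w)%:E = 0.
Proof.
move=> mZ [iD cD].
have mpre B : measurable B -> measurable (Z @^-1` B).
  by move=> mB; rewrite -[X in measurable X]setTI; exact: mZ.
set s := fset_set (g @` setT).
pose A (i : 'I_(#|`s|)) := Z @^-1` (g @^-1` [set s`_i])%R.
have mA i : measurable (A i) by apply: mpre.
have restrictE i : (fun w => (D w * \1_(A i) w)%:E) = (EFin \o D) \_ (A i).
  apply/funext => w; rewrite patchE indicE; case: ifPn => _ /=.
    by rewrite mulr1.
  by rewrite mulr0.
have iDA i : P.-integrable setT (fun w => (D w * \1_(A i) w)%:E).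
  rewrite restrictE; apply/(integrable_mkcond _ _).1 => //.
  exact: integrable_restrict.
transitivity (\int[P]_w
    \sum_(i < #|`s|) ((s`_i)%R%:E * (D w * \1_(A i) w)%:E)).
  apply: eq_integral => w _; rewrite (fimfunEord g) mulr_suml sumEFin.
  congr EFin; apply: eq_bigr => i _; rewrite /A !indicE.
  by rewrite -mulrA [in RHS](mulrC (D w)).
rewrite (integral_sum measurableT) => [|i]; last first.
  exact: (integrableZl measurableT _ (iDA i)).
rewrite big1// => i _; rewrite integralZl// restrictE -integral_mkcond cD//.
by rewrite mule0.
Qed.

(** Simple functions increasing to [k] give integrands dominated by the absolute value of the limit,
    so integrability of the product suffices for dominated convergence. *)
Lemma integral_centered_given_ge0 Z D k :
  measurable_fun setT Z -> measurable_fun setT k -> (forall z, 0 <= k z)%R ->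
  centered_given Z D ->
  P.-integrable setT (fun w => (k (Z w) * D w)%:E) ->
  \int[P]_w (k (Z w) * D w)%:E = 0.
Proof.
move=> mZ mk k0 cD ikD.
move/measurable_EFinP: (mk) => mek.
pose g := nnsfun_approx measurableT mek.
have mD : measurable_fun setT D.
  by apply/measurable_EFinP; exact: measurable_int cD.1.
have gk z : (g n z @[n --> \oo] --> k z)%R.
  have k0E x : setT x -> 0 <= (EFin \o k) x by rewrite lee_fin.
  have /fine_cvgP[_] : EFin \o g ^~ z @ \oo --> (k z)%:E.
    exact: (cvg_nnsfun_approx measurableT mek k0E).
  exact: cvg_trans.
have kle n z : (g n z <= k z)%R.
  have gz : nondecreasing_seq (g ^~ z).
    by move=> m p mp; exact/lefP/nd_nnsfun_approx.
  have := nondecreasing_cvgn_le gz (cvgP (k z) (gk z)) n.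
  by rewrite (cvg_lim _ (gk z)).
have [|||||_ _] := @dominated_convergence _ T R P setT measurableT
  (fun n w => (g n (Z w) * D w)%:E) (fun w => (k (Z w) * D w)%:E)
  (fun w => `|(k (Z w) * D w)%:E|).
- move=> n; apply/measurable_EFinP; apply: measurable_funM => //.
  exact: measurableT_comp.
- exact: measurable_int ikD.
- apply: aeW => w _; apply: cvg_EFin; first exact: nearW.
  by apply: cvgM; [exact: gk|exact: cvg_cst].
- exact: integrable_abse.
- apply: aeW => w n _; rewrite lee_fin !normrM ler_wpM2r//.
  by rewrite !ger0_norm.
under eq_fun do rewrite integral_centered_given_nnsfun//.
by move=> /cvg_lim <- //; rewrite lim_cst.
Qed.

Lemma integral_centered_given Z D k :
  measurable_fun setT Z -> measurable_fun setT k -> centered_given Z D ->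
  P.-integrable setT (fun w => (k (Z w) * D w)%:E) ->
  \int[P]_w (k (Z w) * D w)%:E = 0.
Proof.
move=> mZ mk cD ikD.
have ik (h : S -> R) : measurable_fun setT h -> (forall z, `|h z| <= `|k z|)%R ->
    P.-integrable setT (fun w => (h (Z w) * D w)%:E).
  move=> mh hk; apply: le_integrable ikD => //.
    apply/measurable_EFinP; apply: measurable_funM; first exact: measurableT_comp.
    by apply/measurable_EFinP; exact: measurable_int cD.1.
  by move=> w _; rewrite /= !normrM lee_fin ler_wpM2r.
have mp : measurable_fun setT (k ^\+)%R by exact: measurable_funrpos.
have mn : measurable_fun setT (k ^\-)%R by exact: measurable_funrneg.
have ip : P.-integrable setT (fun w => ((k ^\+)%R (Z w) * D w)%:E).
  apply: ik => // z; rewrite ger0_norm ?funrpos_ge0// /funrpos.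
  by rewrite ge_max ler_norm normr_ge0.
have ineg : P.-integrable setT (fun w => ((k ^\-)%R (Z w) * D w)%:E).
  apply: ik => // z; rewrite ger0_norm ?funrneg_ge0// /funrneg.
  by rewrite ge_max -normrN ler_norm normr_ge0.
transitivity (\int[P]_w (((k ^\+)%R (Z w) * D w)%:E - ((k ^\-)%R (Z w) * D w)%:E)).
  apply: eq_integral => w _; rewrite -EFinB -mulrBl; congr (_ * _)%:E.
  by have /(congr1 (fun h => h (Z w))) := esym (funrposBneg k).
rewrite integralB//.
by rewrite !integral_centered_given_ge0 ?sube0.
Qed.

End CenteredGiven.

(** * Conditioning preserves square integrability *)

Section SquareIntegrable.
Local Open Scope ereal_scope.
Import numFieldNormedType.Exports.
Context {dT : measure_display} {T : measurableType dT} {R : realType}.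

Lemma sqr_lty_Lfun2 (mu : {measure set T -> \bar R}) (W : T -> R) :
  measurable_fun setT W -> \int[mu]_w (W w ^+ 2)%:E < +oo ->
  W \in Lfun mu 2%:E.
Proof.
move=> mW W2; rewrite inE; apply/andP; split; rewrite inE//=.
rewrite /finite_norm unlock poweR_lty// (le_lt_trans _ W2)//.
rewrite le_eqVlt; apply/orP; left; apply/eqP; apply: eq_integral => w _ /=.
by rewrite powR_mulrn// -normrX ger0_norm// sqr_ge0.
Qed.

Context {dZ : measure_display} {S : measurableType dZ} (P : probability T R).

Let trunc (k : S -> R) (n : nat) (z : S) : R :=
  (k z * \1_[set z | (`|k z| <= n%:R)%R] z)%R.

Let measurable_trunc k n : measurable_fun setT k ->
  measurable_fun setT (trunc k n).
Proof.
move=> mk; apply: measurable_funM => //; apply: measurable_indic.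
rewrite -[X in measurable X]setTI.
apply: (measurable_fun_le measurableT) => //.
by apply: measurableT_comp.
Qed.

Let truncE k n z : trunc k n z = if (`|k z| <= n%:R)%R then k z else 0%R.
Proof.
rewrite /trunc indicE; case: ifPn => kz; first by rewrite mem_set ?mulr1.
by rewrite memNset ?mulr0//=; apply/negP.
Qed.

Let normr_trunc k n z : (`|trunc k n z| <= n%:R)%R.
Proof. by rewrite truncE; case: ifPn => // _; rewrite normr0. Qed.

(* Truncating [k] at height [n] makes the orthogonality relation available
   before square integrability is known; then [a^2 <= Y^2 - 2 a (Y - k)] when
   [a] is [k] or [0] bounds the truncated second moments by that of [Y]. *)
Lemma centered_given_Lfun2 (Z : T -> S) (k : S -> R) (Y : T -> R) :
  measurable_fun setT Z -> measurable_fun setT k -> Y \in Lfun P 2%:E ->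
  centered_given P Z (Y \- (k \o Z))%R -> (k \o Z : T -> R) \in Lfun P 2%:E.
Proof.
move=> mZ mk Y2 cY.
have mkZ : measurable_fun setT (k \o Z) by exact: measurableT_comp.
have mtZ n : measurable_fun setT (trunc k n \o Z).
  by apply: measurableT_comp => //; exact: measurable_trunc.
have iY2 := Lfun2_integrable_sqr Y2.
have itD n : P.-integrable setT
    (fun w => (trunc k n (Z w) * (Y \- (k \o Z))%R w)%:E).
  apply: (@le_integrable _ _ _ _ _ measurableT _
      (fun w => n%:R%:E * ((Y \- (k \o Z))%R w)%:E)).
  - apply/measurable_EFinP; apply: measurable_funM; first exact: mtZ.
    by apply/measurable_EFinP; exact: measurable_int cY.1.
  - move=> w _; rewrite -EFinM /= lee_fin normrM [in leRHS]normrM ler_wpM2r//.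
    by rewrite (ger0_norm (ler0n _ _)); exact: normr_trunc.
  - exact: (integrableZl measurableT _ cY.1).
have t2le n : \int[P]_w ((trunc k n (Z w)) ^+ 2)%:E <= \int[P]_w (Y w ^+ 2)%:E.
  apply: (@le_trans _ _ (\int[P]_w ((Y w ^+ 2)%:E -
      2%:E * (trunc k n (Z w) * (Y \- (k \o Z))%R w)%:E))).
    apply: ge0_le_integral => //.
    - by move=> w _; rewrite lee_fin sqr_ge0.
    - by apply/measurable_EFinP; apply: measurable_funX; exact: mtZ.
    - apply: emeasurable_funB; first exact: measurable_int iY2.
      by apply: measurable_funeM; exact: measurable_int (itD n).
    - move=> w _; rewrite -EFinM -EFinB lee_fin truncE.
      case: ifPn => _; last by rewrite mul0r mulr0 subr0 expr0n sqr_ge0.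
      rewrite -subr_ge0 [X in (0 <= X)%R](_ : _ = ((Y w - k (Z w)) ^+ 2)%R) ?sqr_ge0//=.
      by ring.
  rewrite integralB//; last exact: (integrableZl measurableT).
  rewrite integralZl// (integral_centered_given mZ (measurable_trunc n mk) cY (itD n)).
  by rewrite mule0 sube0.
apply: sqr_lty_Lfun2 => //.
have Y2oo : \int[P]_w (Y w ^+ 2)%:E < +oo.
  have := integrable_fin_num measurableT iY2.
  by rewrite ge0_fin_numE//; apply: integral_ge0 => w _; rewrite lee_fin sqr_ge0.
apply: le_lt_trans Y2oo.
(* At each point the truncations are eventually equal to [k]; monotone convergence then passes the
   uniform bound [t2le] to the limit. *)
have cvgt z : (trunc k n z ^+ 2)%:E @[n --> \oo] --> (k z ^+ 2)%:E.
  apply: cvg_near_cst; exists (Num.truncn `|k z|).+1 => // n /= kn.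
  by rewrite truncE ifT// (le_trans (ltW (truncnS_gt _)))// ler_nat.
have -> : \int[P]_w (((k \o Z) w) ^+ 2)%:E =
    \int[P]_w (limn (fun n => (trunc k n (Z w) ^+ 2)%:E)).
  by apply: eq_integral => w _; apply/esym/cvg_lim => //; exact: cvgt.
have nd w : nondecreasing_seq (fun n => (trunc k n (Z w) ^+ 2)%:E).
  move=> m n mn; rewrite lee_fin !truncE; case: ifPn => [km|_].
    by rewrite ifT// (le_trans km)// ler_nat.
  by rewrite expr0n sqr_ge0.
have mt2 n : measurable_fun setT (fun w => (trunc k n (Z w) ^+ 2)%:E).
  by apply/measurable_EFinP; apply: measurable_funX; exact: mtZ.
rewrite monotone_convergence//; last first.
  by move=> n w _; rewrite lee_fin sqr_ge0.
apply: lime_le; last exact: nearW.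
apply: ereal_nondecreasing_is_cvgn => m n mn; apply: ge0_le_integral => //.
- by move=> w _; rewrite lee_fin sqr_ge0.
- by move=> w _; exact: nd.
Qed.

End SquareIntegrable.

(** * Zero covariance and factorization over independent events *)

Section ConditionalCovariance.
Local Open Scope ereal_scope.
Import numFieldNormedType.Exports.
Context {dT dZ : measure_display} {T : measurableType dT}
  {S : measurableType dZ} {R : realType} (P : probability T R).

Lemma is_cond_expectation_centered (Y : T -> R) (Z : T -> S) (W : T -> R) :
  measurable_fun setT Z -> P.-integrable setT (EFin \o Y) ->
  is_cond_expectation P Y Z W -> centered_given P Z (Y \- W)%R.
Proof.
move=> mZ iY [_ iW cW]; split; first exact: (integrableB measurableT iY iW).
move=> C mC.
have mZC : measurable (Z @^-1` C) by rewrite -[X in measurable X]setTI; exact: mZ.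
have iYC := integrable_restrict mZC iY; have iWC := integrable_restrict mZC iW.
rewrite (integralB mZC iYC iWC) cW; last by exists C; rewrite ?setTI.
by rewrite subee//; exact: (integrable_fin_num mZC iYC).
Qed.

Lemma covariance_centered_given (Z : T -> S) (k : S -> R) (D : T -> R) :
  measurable_fun setT Z -> measurable_fun setT k ->
  (k \o Z : T -> R) \in Lfun P 2%:E -> D \in Lfun P 2%:E ->
  centered_given P Z D -> covariance P (k \o Z) D = 0.
Proof.
move=> mZ mk k2 D2 cD.
have Pfin : P setT \is a fin_num := fin_num_measure P _ measurableT.
have k1 := Lfun_subset12 Pfin k2.
have D1 := Lfun_subset12 Pfin D2.
have kD1 : ((k \o Z : T -> R) * D)%R \in Lfun P 1 := Lfun2_mul_Lfun1 k2 D2.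
rewrite covarianceE// !unlock.
rewrite (integral_centered_given mZ mk cD); last exact/Lfun1_integrable.
by have := cD.2 setT measurableT; rewrite preimage_setT => ->; rewrite mule0 sube0.
Qed.

(** Independence of [A] from Z is encoded by the centered indicator of [A] being centered given Z;
    pairing that variable with [h] is the product formula. *)
Lemma integral_indep_event (Z : T -> S) (h : S -> R) (A : set T) :
  measurable_fun setT Z -> measurable_fun setT h -> measurable A ->
  centered_given P Z (fun w => \1_A w - fine (P A))%R ->
  P.-integrable setT (fun w => (h (Z w))%:E) ->
  \int[P]_(w in A) (h (Z w))%:E = P A * \int[P]_w (h (Z w))%:E.
Proof.
move=> mZ mh mA cA ih.
have AE : (fun w => (h (Z w) * \1_A w)%:E) = (fun w => (h (Z w))%:E) \_ A.
  apply/funext => w; rewrite patchE indicE; case: ifPn => _ /=.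
    by rewrite mulr1.
  by rewrite mulr0.
have iA : P.-integrable setT (fun w => (h (Z w) * \1_A w)%:E).
  rewrite AE; apply/(integrable_mkcond _ _).1 => //.
  exact: integrableS ih.
have PA : P A = (fine (P A))%:E by rewrite fineK// fin_num_measure.
have DE : (fun w => (h (Z w) * (\1_A w - fine (P A)))%:E) =
    (fun w => (h (Z w) * \1_A w)%:E) \- (fun w => (fine (P A))%:E * (h (Z w))%:E).
  apply/funext => w.
  rewrite [RHS](_ : _ = (h (Z w) * \1_A w - fine (P A) * h (Z w))%:E)//.
  by rewrite mulrBr (mulrC (fine _)).
have iPA : P.-integrable setT (fun w => (fine (P A))%:E * (h (Z w))%:E).
  exact: (integrableZl measurableT).
have iD : P.-integrable setT (fun w => (h (Z w) * (\1_A w - fine (P A)))%:E).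
  by rewrite DE; exact: integrableB.
rewrite [in RHS]PA; have := integral_centered_given mZ mh cA iD.
rewrite DE integralB// AE -integral_mkcond integralZl// => E0.
have fh := integrable_fin_num measurableT ih.
have fA : \int[P]_(w in A) (h (Z w))%:E \is a fin_num.
  by apply: integrable_fin_num => //; exact: integrableS ih.
by have /eqP := E0; rewrite sube_eq// add0e => /eqP ->.
Qed.

(** The restriction to Z in [C] is absorbed into the function of Z, as [h \* \1_C]. *)
Lemma integral_indep_setI (Z : T -> S) (h : S -> R) (C : set S) (A : set T) :
  measurable_fun setT Z -> measurable_fun setT h -> measurable C ->
  measurable A -> centered_given P Z (fun w => \1_A w - fine (P A))%R ->
  P.-integrable setT (fun w => (h (Z w))%:E) ->
  \int[P]_(w in A `&` Z @^-1` C) (h (Z w))%:E =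
  P A * \int[P]_(w in Z @^-1` C) (h (Z w))%:E.
Proof.
move=> mZ mh mC mA cA ih.
have mZC : measurable (Z @^-1` C) by rewrite -[X in measurable X]setTI; exact: mZ.
have CE : (fun w => ((h \* \1_C)%R (Z w))%:E) =
    (fun w => (h (Z w))%:E) \_ (Z @^-1` C).
  apply/funext => w; rewrite patchE /= indicE.
  have -> : (Z w \in C) = (w \in Z @^-1` C) by apply/idP/idP; rewrite !inE.
  by case: ifPn => _; rewrite ?mulr1 ?mulr0.
rewrite integral_mkcondr [in RHS]integral_mkcond -CE.
apply: (@integral_indep_event Z (h \* \1_C)%R) => //.
  by apply: measurable_funM => //; exact: measurable_indic.
rewrite CE; apply/(integrable_mkcond _ _).1 => //.
exact: integrableS ih.
Qed.

End ConditionalCovariance.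

(** * Independence of cylinders under a product law *)

Section ProductLaw.
Local Open Scope ereal_scope.
Context {R : realType} {d : nat} {E : 'I_d -> ptopologicalType}.
Hypothesis polishE : forall i, polish_space R (E i).
Context {disp : measure_display} {T : measurableType disp} (P : probability T R)
  (X : {RV P >-> borel (fullprod E)}).
Implicit Types (A B C : {set 'I_d}) (F : forall i, set (E i)).

Local Notation Z A := (@restr d E A \o X : T -> borel (subprod E A)).

Lemma measurable_restr_comp A : measurable_fun setT (Z A).
Proof. by apply: measurableT_comp => //; exact: measurable_restr. Qed.

Definition cyl A F : set T := [set w | forall i, i \in A -> F i (X w i)].

Lemma preimage_subbox A F : Z A @^-1` subbox A F = cyl A F.
Proof.
apply/seteqP; split=> [w wF i iA|w wF [i iA]]; last exact: wF.
exact: (wF (exist _ i iA)).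
Qed.

Lemma measurable_subbox A F : (forall i, open (F i)) ->
  measurable (subbox A F : set (borel (subprod E A))).
Proof. by move=> oF; apply: sub_sigma_algebra; exact: open_subbox. Qed.

Lemma measurable_cyl A F : (forall i, open (F i)) -> measurable (cyl A F).
Proof.
move=> oF; rewrite -preimage_subbox -[X in measurable X]setTI.
by apply: measurable_restr_comp => //; exact: measurable_subbox.
Qed.

Hypothesis XP : is_product_law (distribution P X).

(** Completed by whole-space sides, all three events become boxes over every coordinate. In each
    coordinate at least one of the two sides is the whole space, of probability one, so the products
    match factor by factor. *)
Lemma cyl_indep A B F F' : (forall i, open (F i)) -> (forall i, open (F' i)) ->
  {in A, forall i, i \notin B} -> P (cyl A F `&` cyl B F') = P (cyl A F) * P (cyl B F').
Proof.
move=> oF oF' AB.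
pose side C (G : forall i, set (E i)) i : set (E i) :=
  if i \in C then G i else setT.
have mside C G i : (forall i, open (G i)) ->
    measurable (side C G i : set (borel (E i))).
  by move=> oG; rewrite /side; case: ifPn => _ //; exact: sub_sigma_algebra.
have law (G : forall i, set (E i)) :
    (forall i, measurable (G i : set (borel (E i)))) ->
    P [set w | forall i, G i (X w i)] = \prod_(i < d) P [set w | G i (X w i)].
  exact: (XP (B := G)).
have cylE C G : cyl C G = [set w | forall i, side C G i (X w i)].
  apply/seteqP; split=> w wG i; first by rewrite /side; case: ifPn => // /wG.
  by move=> iC; have := wG i; rewrite /side iC.
rewrite !cylE !law//; [|by move=> i; exact: mside..].
rewrite -big_split/= (_ : _ `&` _ =
  [set w | forall i, (side A F i `&` side B F' i) (X w i)]); last first.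
  apply/seteqP; split=> [w [w1 w2] i|w w12]; first by split; [exact: w1|exact: w2].
  by split=> i; case: (w12 i).
rewrite (law (fun i => side A F i `&` side B F' i)) => [|i]; last by apply: measurableI; exact: mside.
apply: eq_bigr => i _; rewrite /side.
have PT : P [set w | [set: E i] (X w i)] = 1.
  by rewrite -(@probability_setT _ _ _ P); congr (P _); apply/seteqP; split.
case: ifPn => iA; last by rewrite setTI PT mul1e.
by rewrite (negbTE (AB i iA)) setIT PT mule1.
Qed.

Lemma centered_given_cyl A B F : (forall i, open (F i)) -> {in A, forall i, i \notin B} ->
  centered_given P (Z A) (fun w => \1_(cyl B F) w - fine (P (cyl B F)))%R.
Proof.
move=> oF AB; have mF := measurable_cyl B oF.
have i1 : P.-integrable setT (EFin \o \1_(cyl B F)).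
  exact: integrable_indic.
have ic : P.-integrable setT (EFin \o cst (fine (P (cyl B F)))).
  exact/Lfun1_integrable/Lfun_cst.
apply: (@centered_given_generated _ _ T (borel (subprod E A)) R P (Z A)
  _ (open_subboxes A)).
- exact: measurable_restr_comp.
- exact: borel_subprodE.
- exact: setI_closed_open_subboxes.
- by exists (fun=> setT) => [i|]; [exact: openT|apply/seteqP; split].
- exact: (integrableB measurableT i1 ic).
move=> _ [F' oF' ->]; rewrite preimage_subbox.
have mF' := measurable_cyl A oF'.
rewrite (@integralB_EFin _ _ _ P _ (\1_(cyl B F)) (cst (fine (P (cyl B F)))))//=.
- rewrite integral_indic// integral_cst// [X in X - _](_ : _ =
      P (cyl A F') * P (cyl B F)); last by rewrite setIC; exact: cyl_indep.
  by rewrite fineK ?fin_num_measure// muleC subee// fin_numM// fin_num_measure.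
- exact: integrableS i1.
- exact: integrableS ic.
Qed.

End ProductLaw.

(** * Conditional expectations under independence *)

Section ConditionalExpectations.
Local Open Scope ereal_scope.
Import numFieldNormedType.Exports.
Context {R : realType} {d : nat} {E : 'I_d -> ptopologicalType}.
Hypothesis polishE : forall i, polish_space R (E i).
Context {disp : measure_display} {T : measurableType disp} (P : probability T R)
  (X : {RV P >-> borel (fullprod E)}).
Implicit Types (A B C : {set 'I_d}) (F : forall i, set (E i)) (Y : T -> R).

Local Notation Z A := (@restr d E A \o X : T -> borel (subprod E A)).

Lemma integral_centered_givenB {dZ : measure_display} {S : measurableType dZ}
    (V : T -> S) (Y W : T -> R) (K : set S) :
  measurable_fun setT V -> measurable K ->
  P.-integrable setT (EFin \o Y) -> P.-integrable setT (EFin \o W) ->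
  centered_given P V (Y \- W)%R ->
  \int[P]_(w in V @^-1` K) (W w)%:E = \int[P]_(w in V @^-1` K) (Y w)%:E.
Proof.
move=> mV mK iY iW [_ cYW].
have mVK : measurable (V @^-1` K) by rewrite -[X in measurable X]setTI; exact: mV.
have iYK := integrable_restrict mVK iY; have iWK := integrable_restrict mVK iW.
have /eqP := cYW K mK; rewrite (integralB mVK iYK iWK) sube_eq.
- by rewrite add0e => /eqP ->.
- exact: (integrable_fin_num mVK iYK).
- by rewrite fin_num_adde_defr.
Qed.

(* Independence of the coordinates in [C :\: B] from those in [B] factors both
   integrals over a box of [C] through the same event of [B :&: C], where the
   two conditional expectations integrate like [Y]. *)
Lemma centered_given_setI Y B C
    (f : borel (subprod E B) -> R) (g : borel (subprod E (B :&: C)) -> R) :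
  is_product_law (distribution P X) ->
  measurable_fun setT f -> measurable_fun setT g ->
  P.-integrable setT (EFin \o Y) ->
  P.-integrable setT (EFin \o (f \o Z B)) ->
  P.-integrable setT (EFin \o (g \o Z (B :&: C))) ->
  centered_given P (Z B) (Y \- (f \o Z B))%R ->
  centered_given P (Z (B :&: C)) (Y \- (g \o Z (B :&: C)))%R ->
  centered_given P (Z C) ((f \o Z B) \- (g \o Z (B :&: C)))%R.
Proof.
move=> XP mf mg iY iF iG cf cg.
have mZ A : measurable_fun setT (Z A) by exact: measurable_restr_comp.
apply: (@centered_given_generated _ _ T (borel (subprod E C)) R P (Z C)
  _ (open_subboxes C)).
- exact: mZ.
- exact: borel_subprodE.
- exact: setI_closed_open_subboxes.
- by exists (fun=> setT) => [i|]; [exact: openT|apply/seteqP; split].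
- exact: (integrableB measurableT iF iG).
move=> _ [F oF ->]; rewrite preimage_subbox.
(* Relaxing the sides outside [C] turns the cylinder over [B :&: C] into one over [B], hence into an
   event of X_B, over which [f] integrates like [Y]. *)
pose F1 i : set (E i) := if i \in C then F i else setT.
have oF1 i : open (F1 i) by rewrite /F1; case: ifPn => _; [exact: oF|exact: openT].
have S1E : cyl X (B :&: C) F = cyl X B F1.
  apply/seteqP; split=> w wF i.
    by move=> iB; rewrite /F1; case: ifPn => // iC; apply: wF; rewrite inE iB.
  by rewrite inE => /andP[iB iC]; have := wF i iB; rewrite /F1 iC.
have CE : cyl X C F = cyl X (C :\: B) F `&` cyl X (B :&: C) F.
  apply/seteqP; split=> [w wF|w [w1 w2] i iC].
    by split=> i; rewrite inE => /andP[? ?]; apply: wF.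
  have [iB|iB] := boolP (i \in B); first by apply: w2; rewrite inE iB.
  by apply: w1; rewrite inE iB.
have mC := measurable_cyl polishE X C oF.
rewrite (integralB mC (integrable_restrict mC iF) (integrable_restrict mC iG)).
have mS2 := measurable_cyl polishE X (C :\: B) oF.
have If : \int[P]_(w in cyl X C F) (f (Z B w))%:E =
    P (cyl X (C :\: B) F) * \int[P]_(w in cyl X (B :&: C) F) (Y w)%:E.
  rewrite CE S1E -(preimage_subbox X B F1) integral_indep_setI//.
  - congr (_ * _); apply: (integral_centered_givenB _ _ iY iF cf) => //.
    exact: measurable_subbox.
  - exact: measurable_subbox.
  - by apply: centered_given_cyl => // i iB; rewrite inE iB.
have Ig : \int[P]_(w in cyl X C F) (g (Z (B :&: C) w))%:E =
    P (cyl X (C :\: B) F) * \int[P]_(w in cyl X (B :&: C) F) (Y w)%:E.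
  rewrite CE -(preimage_subbox X (B :&: C) F) integral_indep_setI//.
  - congr (_ * _); apply: (integral_centered_givenB _ _ iY iG cg) => //.
    exact: measurable_subbox.
  - exact: measurable_subbox.
  - by apply: centered_given_cyl => // i; rewrite !inE => /andP[-> _].
rewrite /= If Ig subee// fin_numM ?fin_num_measure//.
apply: integrable_fin_num; first exact: measurable_cyl.
exact: integrable_restrict (measurable_cyl polishE X _ oF) iY.
Qed.

End ConditionalExpectations.

(** * Covariances of the conditional expectations *)

Section Covariances.
Local Open Scope ereal_scope.
Import numFieldNormedType.Exports.

Lemma Lfun2_distribution {dT dS : measure_display} {T : measurableType dT}
    {S : measurableType dS} {R : realType} (P : probability T R)
    (X : {RV P >-> S}) (H : S -> R) : measurable_fun setT H ->
  H \in Lfun (distribution P X) 2%:E <-> (H \o X : T -> R) \in Lfun P 2%:E.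
Proof.
move=> mH.
have mHX : measurable_fun setT (H \o X) by exact: measurableT_comp.
have H2E : \int[distribution P X]_x (H x ^+ 2)%:E = \int[P]_w (H (X w) ^+ 2)%:E.
  rewrite ge0_integral_distribution//.
  - by apply/measurable_EFinP; exact: measurable_funX.
  - by move=> x; rewrite lee_fin sqr_ge0.
have sqr_lty d' (U : measurableType d') (mu : {measure set U -> \bar R}) (K : U -> R) :
    K \in Lfun mu 2%:E -> \int[mu]_x (K x ^+ 2)%:E < +oo.
  move=> /Lfun2_integrable_sqr/(integrable_fin_num measurableT).
  by rewrite ge0_fin_numE//; apply: integral_ge0 => w _; rewrite lee_fin sqr_ge0.
split=> /sqr_lty h; apply: sqr_lty_Lfun2 => //; last by rewrite H2E.
by rewrite -H2E.
Qed.

Context {R : realType} {d : nat} {E : 'I_d -> ptopologicalType}.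
Hypothesis polishE : forall i, polish_space R (E i).
Context {disp : measure_display} {T : measurableType disp} (P : probability T R)
  (X : {RV P >-> borel (fullprod E)}).
Implicit Types (A B C : {set 'I_d}).

Local Notation Z A := (@restr d E A \o X : T -> borel (subprod E A)).

Context (Y : T -> R) (Y2 : Y \in Lfun P 2%:E)
  (f : forall A, borel (subprod E A) -> R)
  (mf : forall A, measurable_fun setT (@f A))
  (hf : forall A, is_cond_expectation P Y (Z A) (@f A \o Z A)).

Local Notation W A := (@f A \o Z A : T -> R).

Let mZ A : measurable_fun setT (Z A).
Proof. exact: measurable_restr_comp. Qed.

Let Pfin : P setT \is a fin_num.
Proof. exact: fin_num_measure. Qed.

Let centeredW A : centered_given P (Z A) (Y \- W A)%R.
Proof.
apply: is_cond_expectation_centered => //.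
exact/Lfun1_integrable/Lfun_subset12.
Qed.

Lemma cond_expectation_Lfun2 A : W A \in Lfun P 2%:E.
Proof. exact: centered_given_Lfun2 (centeredW A). Qed.

Lemma covariance_cond_expectation B C : is_product_law (distribution P X) ->
  covariance P (W B) (W C) = variance P (W (B :&: C)).
Proof.
move=> XP.
have iL (V : T -> R) : V \in Lfun P 2%:E -> P.-integrable setT (EFin \o V).
  by move=> V2; exact/Lfun1_integrable/Lfun_subset12.
have W2 := cond_expectation_Lfun2.
have step B' C' : covariance P (W C') (W B') = covariance P (W C') (W (B' :&: C')).
  have : covariance P (W C') (W B' \- W (B' :&: C'))%R = 0.
    apply: covariance_centered_given => //; [exact: W2| |].
      by rewrite rpredB ?lee1n//= => _; exact: W2.
    exact: (centered_given_setI polishE XP (@mf B') (@mf (B' :&: C')) (iL _ Y2)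
      (iL _ (W2 _)) (iL _ (W2 _)) (@centeredW _) (@centeredW _)).
  rewrite covarianceBr; [|exact: W2..] => /eqP; rewrite sube_eq ?add0e.
  - by move/eqP.
  - by rewrite covariance_fin_num ?Lfun2_mul_Lfun1 ?Lfun_subset12.
  - by rewrite fin_num_adde_defr.
(* [step] replaces the two arguments in turn: first [W B] against [C], then [W C] against [B :&: C],
   both becoming [W (B :&: C)]. *)
by rewrite covarianceC step covarianceC step finset.setICA finset.setIid.
Qed.

(** Almost sure equality is bypassed: Y - W_D is uncorrelated with every square-integrable function
    of X_D, in particular with both W_D and Y, so each variance equals the covariance of W_D and
    Y. *)
Lemma variance_cond_expectation_full (g : borel (fullprod E) -> R) :
  measurable_fun setT g -> Y = g \o X -> variance P (W [set: 'I_d]%SET) = variance P Y.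
Proof.
move=> mg Yg; set D := [set: 'I_d]%SET.
have W2 := cond_expectation_Lfun2 D.
have cov0 (k : borel (subprod E D) -> R) : measurable_fun setT k ->
    (k \o Z D : T -> R) \in Lfun P 2%:E ->
    covariance P (k \o Z D) Y = covariance P (k \o Z D) (W D).
  move=> mk k2; have : covariance P (k \o Z D) (Y \- W D)%R = 0.
    by apply: covariance_centered_given => //; rewrite rpredB ?lee1n//= => _.
  rewrite covarianceBr// => /eqP; rewrite sube_eq ?add0e.
  - by move/eqP.
  - by rewrite covariance_fin_num ?Lfun2_mul_Lfun1 ?Lfun_subset12.
  - by rewrite fin_num_adde_defr.
have YE : Y = (g \o unrestr) \o Z D by rewrite Yg.
have mgu : measurable_fun setT (g \o unrestr : borel (subprod E D) -> R).
  by apply: measurableT_comp => //; exact: measurable_unrestr.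
rewrite /variance -cov0// covarianceC [in X in covariance P X _]YE.
by rewrite -cov0//= -YE.
Qed.

End Covariances.

(** * Moebius inversion on the subsets of D by sign-reversing involutions *)

Section MoebiusInversion.
Context {R : realType} {d : nat}.
Implicit Types (A B C : {set 'I_d}) (s varphi : {set 'I_d} -> R).

(** Symmetric difference with the singleton of [i]: an involution that changes the parity of the
    cardinality, and the source of every cancellation below. *)
Definition toggle (i : 'I_d) A : {set 'I_d} :=
  if i \in A then (A :\ i)%SET else (i |: A)%SET.

Lemma toggleK i : involutive (toggle i).
Proof.
move=> A; rewrite {2}/toggle; case: ifPn => iA.
  by rewrite /toggle !inE eqxx/= finset.setD1K.
by rewrite /toggle !inE eqxx/= finset.setU1K.
Qed.

Lemma in_toggle i A j : (j \in toggle i A) = (j == i) (+) (j \in A).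
Proof.
rewrite /toggle; have [->|ji] := eqVneq j i; case: ifPn => iA.
- by rewrite !inE eqxx iA.
- by rewrite !inE eqxx (negbTE iA).
- by rewrite !inE ji.
- by rewrite !inE (negbTE ji).
Qed.

Lemma sign_toggle i A : (-1) ^+ #|toggle i A| = - (-1) ^+ #|A| :> R.
Proof.
rewrite /toggle; case: ifPn => iA; last by rewrite cardsU1 iA exprS mulN1r.
by rewrite (cardsD1 i A) iA exprS mulN1r opprK.
Qed.

Lemma sum_toggle i (F : {set 'I_d} -> R) :
  (forall A, F (toggle i A) = - F A) -> \sum_A F A = 0.
Proof.
move=> FN; apply/eqP; rewrite -eqNr; apply/eqP.
rewrite [RHS](reindex_inj (inv_inj (toggleK i)))/= -sumrN.
by apply: eq_bigr => A _; rewrite FN.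
Qed.

(** Extending the coefficient by zero lets sums range over all sets, so they can be exchanged and
    reindexed along [toggle] without side conditions. *)
Definition moebius_coeff A B : R :=
  if B \subset A then (-1) ^+ (#|A| - #|B|) else 0.

Lemma moebiusE varphi A :
  moebius varphi A = \sum_B moebius_coeff A B * varphi B.
Proof.
rewrite /moebius big_mkcond/=; apply: eq_bigr => B _; rewrite /moebius_coeff.
by case: ifPn => //; rewrite mul0r.
Qed.

(** On subsets the truncated difference of cardinals has the parity of their sum; the sign then
    splits, and toggling either argument flips it. *)
Lemma moebius_coeffE A B :
  moebius_coeff A B = if B \subset A then (-1) ^+ #|A| * (-1) ^+ #|B| else 0.
Proof.
rewrite /moebius_coeff; case: ifPn => // /subset_leq_card BA.
by rewrite -exprD -signr_odd oddB// -oddD signr_odd.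
Qed.

Lemma subset_toggle i A B : i \in A -> (toggle i B \subset A) = (B \subset A).
Proof.
have sub C : i \in A -> C \subset A -> toggle i C \subset A.
  move=> iA /fintype.subsetP CA; apply/fintype.subsetP => j; rewrite in_toggle.
  by have [->|_] := eqVneq j i => // /CA.
move=> iA; apply/idP/idP; last exact: sub.
by move=> /(sub _ iA); rewrite toggleK.
Qed.

Lemma toggle_subset i A B : i \notin B -> (B \subset toggle i A) = (B \subset A).
Proof.
have sub C : i \notin B -> B \subset C -> B \subset toggle i C.
  move=> iB /fintype.subsetP BC; apply/fintype.subsetP => j jB; rewrite in_toggle.
  by have [ji|_] := eqVneq j i; [rewrite -ji jB in iB|exact: BC].
move=> iB; apply/idP/idP; last exact: sub.
by move=> /(sub _ iB); rewrite toggleK.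
Qed.

(** After exchanging sums, [varphi B] is weighted by the signs of all supersets of [B]; toggling a
    coordinate missing from [B] cancels them unless [B] is full. *)
Lemma sum_moebius varphi : \sum_A moebius varphi A = varphi [set: 'I_d]%SET.
Proof.
under eq_bigr do rewrite moebiusE.
rewrite exchange_big/= (bigD1 [set: 'I_d]%SET)//= [X in _ + X]big1 ?addr0.
- rewrite -mulr_suml (bigD1 [set: 'I_d]%SET)//= big1 ?addr0.
    by rewrite /moebius_coeff fintype.subxx subnn expr0 mul1r.
  by move=> A; rewrite -finset.subTset /moebius_coeff => /negbTE ->.
- move=> B BT; rewrite -mulr_suml.
  have [i _ iB] : exists2 i, i \in [set: 'I_d]%SET & i \notin B.
    by apply/subsetPn; rewrite finset.subTset.
  rewrite (sum_toggle (i := i)) ?mul0r// => A.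
  rewrite !moebius_coeffE toggle_subset// sign_toggle.
  by case: ifPn => _; rewrite ?oppr0// mulNr.
Qed.

(* For [B] strictly inside [A], toggling in [C] a coordinate of [A :\: B] flips
   the sign and leaves [B :&: C] unchanged, so only [B = A] contributes. *)
Lemma moebius_setI s A :
  \sum_B \sum_C moebius_coeff A B * moebius_coeff A C * s (B :&: C)%SET =
  moebius s A.
Proof.
rewrite (bigD1 A)//= [X in _ + X]big1 ?addr0 => [|B BA].
  rewrite moebiusE; apply: eq_bigr => C _.
  rewrite {1}/moebius_coeff fintype.subxx subnn expr0 mul1r /moebius_coeff.
  by case: ifPn => [CA|_]; rewrite ?mul0r// (finset.setIidPr CA).
have [BsA|BsA] := boolP (B \subset A); last first.
  by apply: big1 => C _; rewrite {1}/moebius_coeff (negbTE BsA) !mul0r.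
have [i iA iB] : exists2 i, i \in A & i \notin B.
  by apply/subsetPn; apply: contra BA => AB; rewrite finset.eqEsubset BsA.
apply: (sum_toggle (i := i)) => C.
have -> : (B :&: toggle i C = B :&: C)%SET.
  apply/setP => j; rewrite !inE in_toggle; have [->|_] := eqVneq j i => //.
  by rewrite (negbTE iB).
rewrite !moebius_coeffE subset_toggle// sign_toggle.
by case: (C \subset A); rewrite ?mulr0 ?mul0r ?oppr0// !(mulrN, mulNr).
Qed.

End MoebiusInversion.

(** * Positivity of the covariance form *)

Section CovarianceForm.
Context {disp : measure_display} {T : measurableType disp} {R : realType}
  (P : probability T R) {I : finType} (V : I -> T -> R)
  (V2 : forall i, V i \in Lfun P 2%:E).
Implicit Type a : I -> R.

Let lincomb_cons a i (r : seq I) :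
  (fun w => \sum_(j <- i :: r) a j * V j w) =
  a i \o* V i \+ (fun w => \sum_(j <- r) a j * V j w).
Proof. by apply/funext => w /=; rewrite big_cons mulrC. Qed.

Lemma Lfun2_lincomb a (r : seq I) :
  (fun w => \sum_(i <- r) a i * V i w) \in Lfun P 2%:E.
Proof.
elim: r => [|i r ih].
  by under eq_fun do rewrite big_nil; exact: Lfun_cst.
rewrite lincomb_cons.
by rewrite rpredD ?lee1n//= => _; rewrite Lfun_scale// ler1n.
Qed.

Lemma fine_covariance_lincomb a (r : seq I) (U : T -> R) :
  U \in Lfun P 2%:E ->
  fine (covariance P (fun w => \sum_(i <- r) a i * V i w) U) =
  \sum_(i <- r) a i * fine (covariance P (V i) U).
Proof.
move=> U2; have Pfin : P setT \is a fin_num := fin_num_measure P _ measurableT.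
have cfin (K L : T -> R) : K \in Lfun P 2%:E -> L \in Lfun P 2%:E ->
    covariance P K L \is a fin_num.
  by move=> K2 L2; rewrite covariance_fin_num ?Lfun2_mul_Lfun1 ?Lfun_subset12.
elim: r => [|i r ih].
  rewrite big_nil; under eq_fun do rewrite big_nil.
  by rewrite (covariance_cst_l P 0 U).
rewrite lincomb_cons.
have aV2 : a i \o* V i \in Lfun P 2%:E by rewrite Lfun_scale// ler1n.
rewrite covarianceDl ?Lfun2_lincomb// fineD ?cfin ?Lfun2_lincomb// ih big_cons.
rewrite covarianceZl ?Lfun2_mul_Lfun1 ?Lfun_subset12//.
by rewrite fineM// cfin.
Qed.

(** The quadratic form is the variance of the linear combination of the [V i] with coefficients
    [a i]. *)
Lemma covariance_psd a :
  0 <= \sum_i \sum_j a i * a j * fine (covariance P (V i) (V j)).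
Proof.
pose L := fun w => \sum_i a i * V i w.
have L2 : L \in Lfun P 2%:E by exact: Lfun2_lincomb.
rewrite (_ : \sum_i _ = fine (covariance P L L)).
  by apply: fine_ge0; exact: variance_ge0.
rewrite [RHS]fine_covariance_lincomb//; apply: eq_bigr => i _.
rewrite [in RHS]covarianceC [in RHS]fine_covariance_lincomb// mulr_sumr.
by apply: eq_bigr => j _; rewrite mulrA [in RHS]covarianceC.
Qed.

End CovarianceForm.

Theorem proposition1 (R : realType) (d : nat) (hd : (0 < d)%N)
    (E : 'I_d -> ptopologicalType) (hE : forall i, polish_space R (E i))
    (disp : measure_display) (T : measurableType disp) (P : probability T R)
    (X : {RV P >-> borel (fullprod E)})
    (G : borel (fullprod E) -> R) (hG : G \in Lfun (distribution P X) 2%:E)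
    (f : forall A : {set 'I_d}, borel (subprod E A) -> R)
    (mf : forall A : {set 'I_d}, measurable_fun [set: borel (subprod E A)] (f A))
    (hf : forall A : {set 'I_d},
       is_cond_expectation P (G \o X)
         (@restr d E A \o X : T -> borel (subprod E A))
         (f A \o @restr d E A \o X)) :
  let V := output_variance P X G in
  let varphi (A : {set 'I_d}) := output_variance P X (f A \o @restr d E A) in
  let psi := moebius varphi in
  [/\ moebius_decomposition V varphi psi,
      gradual [set H : borel (fullprod E) -> R
                 | H \in Lfun (distribution P X) 2%:E]
              (output_variance P X) varphi
    & is_product_law (distribution P X) -> V != 0 ->
      [/\ fractional V psi,
          forall A : {set 'I_d}, 0 <= psi A,
          forall A : {set 'I_d}, 0 <= psi A / V <= 1
        & \sum_(A : {set 'I_d}) psi A / V = 1]].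
Proof.
move=> V varphi psi.
have mG : measurable_fun setT G by move: hG; rewrite inE => /andP[]; rewrite inE.
have Y2 : (G \o X : T -> R) \in Lfun P 2%:E by exact/(Lfun2_distribution X mG).
have W2 A := cond_expectation_Lfun2 hE Y2 mf hf A.
have mfr A : measurable_fun setT (f A \o @restr d E A : borel (fullprod E) -> R).
  by apply: measurableT_comp => //; exact: measurable_restr.
have varphiT : varphi [set: 'I_d]%SET = V.
  rewrite /varphi /V /output_variance.
  by rewrite -(variance_cond_expectation_full hE Y2 mf hf mG erefl).
have sumpsi : \sum_A psi A = V by rewrite sum_moebius.
split; first by split.
- move=> A; exists (f A); split => //.
  by apply/(Lfun2_distribution X (mfr A)); exact: W2.
- move=> XP V0.
  have psi_ge0 A : 0 <= psi A.
    (* Read from right to left, this turns a single signed sum into a quadratic form with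
       coefficients [moebius_coeff A], whose matrix entries are the covariances. *)
    rewrite -[psi A]moebius_setI.
    rewrite (_ : \sum_B _ = \sum_B \sum_C moebius_coeff A B * moebius_coeff A C *
      fine (covariance P (f B \o @restr d E B \o X) (f C \o @restr d E C \o X))).
      exact: (covariance_psd W2).
    apply: eq_bigr => B _; apply: eq_bigr => C _; congr (_ * _).
    by rewrite (covariance_cond_expectation hE Y2 mf hf).
  have Vgt0 : 0 < V.
    by rewrite lt0r V0 -sumpsi; apply: sumr_ge0 => A _; exact: psi_ge0.
  split=> //.
  + by split=> // A; rewrite Vgt0.
  + move=> A; rewrite divr_ge0// ?(ltW Vgt0)//= ler_pdivrMr// mul1r -sumpsi.
    rewrite (bigD1 A)//= lerDl; apply: sumr_ge0 => B _; exact: psi_ge0.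
  + by rewrite -mulr_suml sumpsi divff.
Qed.
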